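(* Let $\mathbf{g}=\{g(n)\}_{n\geqslant 1}$ and $\mathbf{f}=\{f(n)\}_{n\geqslant 1}$ be the coefficient sequences defined by $$\sum_{n\geqslant 1}g(n)z^n=\sum_{k=0}^\infty\frac{z^{2^k}}{1-z^{2^k}},\qquad \sum_{n\geqslant 1}f(n)z^n=\sum_{k=0}^\infty\frac{z^{2^k}}{1+z^{2^k}}.$$ Then for every $n\geqslant 1$, the determinants of the Hankel matrices $H_n^1(\mathbf{g})=(g(i+j-1))_{1\leqslant i,j\leqslant n}$ and $H_n^1(\mathbf{f})=(f(i+j-1))_{1\leqslant i,j\leqslant n}$ are nonzero.
   Context: For a sequence $\mathbf{u}=\{u(j)\}$, the Hankel matrix is $H_n^p(\mathbf{u}):=(u(p+i+j-2))_{1\leqslant i,j\leqslant n}$. Note $g(n)$ equals the $2$-adic valuation of $2n$ (the ruler function). *)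

(* Defs.v *)
From HB Require Import structures.
From mathcomp Require Import all_boot all_order all_algebra.

Set Implicit Arguments.
Unset Strict Implicit.
Unset Printing Implicit Defensive.

Import GRing.Theory.
Local Open Scope ring_scope.

(* A formal power series over R is given by its coefficient sequence
   nat -> R. *)

Section PowerSeries.
Variable R : comUnitRingType.
Implicit Types (p q : {poly R}) (a u : nat -> R).

(* The first n coefficients of p / q, by long division: the coefficient s_m of
   z^m is determined by q_0 s_m + \sum_(i < m) s_i q_(m - i) = p_m. *)
Fixpoint quot_coefs p q (n : nat) : seq R :=
  if n is m.+1 then
    let s := quot_coefs p q m in
    rcons s ((p`_m - \sum_(i < m) s`_i * q`_(m - i)) / q`_0)
  else [::].

(* The quotient p / q in R[[z]], meaningful when q_0 is a unit
   (see series_quotP). *)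
Definition series_quot p q : nat -> R := fun n => (quot_coefs p q n.+1)`_n.

(* \sum_(k >= 0) F k = a in R[[z]]: the partial sums converge to a in the
   z-adic topology, i.e. each coefficient is eventually constant. *)
Definition series_sum (F : nat -> nat -> R) a : Prop :=
  forall n, exists K0, forall K, (K0 <= K)%N -> \sum_(k < K) F k n = a n.

(* \sum_(n >= 1) u(n) z^n; the value u 0 plays no role. *)
Definition genser1 u : nat -> R := fun n => if n is 0 then 0 else u n.

(* H_n^p(u) = (u(p + i + j - 2)) for 1 <= i, j <= n; the indices of 'I_n start
   at 0, which absorbs the - 2. *)
Definition hankel (p n : nat) u : 'M[R]_n :=
  \matrix_(i < n, j < n) u (p + i + j)%N.

Lemma size_quot_coefs p q n : size (quot_coefs p q n) = n.
Proof. by elim: n => //= n IHn; rewrite size_rcons IHn. Qed.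

Lemma nth_quot_coefs p q n i :
  (i < n)%N -> (quot_coefs p q n)`_i = series_quot p q i.
Proof.
elim: n => // n IHn; rewrite ltnS leq_eqVlt => /orP[/eqP-> //|lt_in].
by rewrite /= nth_rcons size_quot_coefs lt_in IHn.
Qed.

Lemma series_quotP p q : q`_0 \is a GRing.unit ->
  forall n, \sum_(i < n.+1) series_quot p q i * q`_(n - i) = p`_n.
Proof.
move=> Uq n; rewrite big_ord_recr /= subnn {2}/series_quot /=.
rewrite nth_rcons size_quot_coefs ltnn eqxx divrK // addrC.
by under eq_bigr => i _ do rewrite nth_quot_coefs //; rewrite subrK.
Qed.

End PowerSeries.

(* Main.v *)
(* Over F_2 both sequences agree with u(n) = 1 + v_2(n), characterised by
   u(2n+1) = 1 and u(2n+2) = 1 + u(n+1).  Let J be the infinite symmetric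
   tridiagonal matrix over F_2 with off-diagonal entries 1 and diagonal
   0, 1, 1, ..., and let r_i = J^i e_0.  Since J is symmetric, <r_i, r_j>
   depends only on i + j.  As squaring is the identity on F_2 and every column
   sum of J is 1, <r_n, r_n> = \sum_k r_n(k) = 1, while
   <r_n, J r_n> = \sum_(k >= 1) r_n(k) = 1 + r_n(0).  Hence
   u(n+1) = r_n(0) = <r_n, e_0>, so the Hankel matrix of u is L L^T mod 2, where
   the rows of L are the r_i: L is lower unitriangular, and the determinants are
   odd.  (J encodes the continued fraction 1/(x + t), t = 1/(x + 1 + t), of
   \sum_n u(n) x^-n over F_2.) *)
Require Import Defs.
From mathcomp Require Import all_boot all_order all_algebra.
From mathcomp Require Import ring.

Set Implicit Arguments.
Unset Strict Implicit.
Unset Printing Implicit Defensive.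

Import GRing.Theory.
Local Open Scope ring_scope.

Lemma addFF2 (x : 'F_2) : x + x = 0.
Proof. by case: x => [[|[|m]] lt_m2] //; apply/val_inj. Qed.

Lemma mulFF2 (x : 'F_2) : x * x = x.
Proof. by case: x => [[|[|m]] lt_m2] //; apply/val_inj. Qed.

Section Jacobi.
Implicit Types r s : nat -> 'F_2.

(** Each row of J has finite support, so J acts on arbitrary sequences. The missing [r 0] at [k = 0]
    is the zero diagonal entry. *)
Definition jacobi r : nat -> 'F_2 :=
  fun k => (if k is k'.+1 then r k' + r k else 0) + r k.+1.

(** Truncation cuts only the link between [N] and [N.+1]; each side receives the boundary term that
    the other sum already contains. *)
Lemma sum_jacobi_sym r s N :
  \sum_(k < N.+1) jacobi r k * s k + r N * s N.+1 =
  \sum_(k < N.+1) r k * jacobi s k + r N.+1 * s N.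
Proof.
elim: N => [|N IHN]; first by rewrite !big_ord1 /= /jacobi; ring.
rewrite [in LHS]big_ord_recr [in RHS]big_ord_recr /=.
rewrite -(addrK (r N * s N.+1) (\sum_(k < N.+1) jacobi r k * s k)) IHN /jacobi.
ring.
Qed.

(** Columns of J sum to 1 mod 2. Cutting the rows beyond [N] removes one entry of column [N] and
    leaves one of column [N.+1]. *)
Lemma sum_jacobi r N :
  \sum_(k < N.+1) jacobi r k = \sum_(k < N.+1) r k + r N + r N.+1.
Proof.
elim: N => [|N IHN]; first by rewrite !big_ord1 /= /jacobi add0r addFF2 add0r.
rewrite !(big_ord_recr N.+1) /= IHN /jacobi.
set S := \sum_(_ < _) _.
(* Pairs the repeated terms, which cancel only in characteristic 2. *)
transitivity (S + (r N + r N) + (r N.+1 + r N.+1) + r N.+2); first by ring.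
by rewrite !addFF2 !addr0 -(addrA S) addFF2 addr0.
Qed.

(** Products [r k * r k.+1] occur twice and cancel, except the one across the cut. The diagonal
    gives the squares with [k > 0]; adding [r 0] removes that term from the full sum. *)
Lemma sum_mul_jacobi r N :
  \sum_(k < N.+1) r k * jacobi r k =
  r 0%N + \sum_(k < N.+1) r k + r N * r N.+1.
Proof.
elim: N => [|N IHN].
  by rewrite !big_ord1 /= /jacobi addFF2 !add0r.
rewrite !(big_ord_recr N.+1) /= IHN /jacobi.
set S := \sum_(_ < _) _.
transitivity (r 0%N + (S + r N.+1 * r N.+1) + (r N * r N.+1 + r N * r N.+1)
  + r N.+1 * r N.+2); first by ring.
by rewrite addFF2 mulFF2 addr0.
Qed.

Definition jrow (i : nat) : nat -> 'F_2 :=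
  iter i jacobi (fun k => (k == 0%N)%:R).

Lemma jrowS i : jrow i.+1 = jacobi (jrow i).
Proof. by []. Qed.

Lemma jrow_gt i k : (i < k)%N -> jrow i k = 0.
Proof.
elim: i k => [|i IHi] [|k] // lt_ik.
by rewrite jrowS /jacobi !IHi ?addr0 // ltnW // ltnW.
Qed.

Lemma jrow_diag i : jrow i i = 1.
Proof. by elim: i => // i IHi; rewrite jrowS /jacobi IHi !jrow_gt ?addr0. Qed.

Lemma sum_jrow i N : (i < N)%N -> \sum_(k < N) jrow i k = 1.
Proof.
case: N => // N; rewrite ltnS.
elim: i => [|i IHi] lt_iN.
  by rewrite big_ord_recl /= big1 ?addr0.
by rewrite jrowS sum_jacobi IHi ?(ltnW lt_iN) // !jrow_gt ?addr0 // ltnW.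
Qed.

Lemma dot_jrow_shift i j N : (i < N)%N -> (j < N)%N ->
  \sum_(k < N.+1) jrow i.+1 k * jrow j k =
  \sum_(k < N.+1) jrow i k * jrow j.+1 k.
Proof.
move=> lt_iN lt_jN; have := sum_jacobi_sym (jrow i) (jrow j) N.
by rewrite (jrow_gt lt_iN) (jrow_gt lt_jN) mul0r mulr0 !addr0.
Qed.

(** Symmetry moves the powers of J one by one to the left factor, until the right one is e_0; the
    bound on [N] makes the boundary terms vanish. *)
Lemma dot_jrow i j N : (i + j < N)%N ->
  \sum_(k < N) jrow i k * jrow j k = jrow (i + j) 0%N.
Proof.
case: N => // N; rewrite ltnS; elim: j i => [|j IHj] i le_ijN.
  by rewrite addn0 big_ord_recl big1 ?addr0 ?mulr1 // => k _; rewrite mulr0.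
rewrite -dot_jrow_shift ?IHj ?addnS ?addSn // -?addnS //.
  by rewrite (leq_trans _ le_ijN) // addnS ltnS leq_addr.
by rewrite (leq_trans _ le_ijN) // leq_addl.
Qed.

Lemma jrow_even n : jrow n.*2 0%N = 1.
Proof.
rewrite -addnn -(dot_jrow (ltnSn _)); under eq_bigr do rewrite mulFF2.
by rewrite sum_jrow // ltnS leq_addl.
Qed.

Lemma jrow_odd n : jrow n.*2.+1 0%N = 1 + jrow n 0%N.
Proof.
rewrite -addnn -addnS -(dot_jrow (ltnSn _)) jrowS sum_mul_jacobi.
have lt_n : (n < n + n.+1)%N by rewrite addnS ltnS leq_addl.
by rewrite sum_jrow 1?ltnW // (jrow_gt lt_n) mul0r addr0 addrC.
Qed.

(** Here [d n] stands for u(n+1), so odd arguments of u are even indices. *)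
Lemma jrow_unique (d : nat -> 'F_2) :
    (forall n, d n.*2 = 1) -> (forall n, d n.*2.+1 = 1 + d n) ->
  forall n, d n = jrow n 0%N.
Proof.
move=> d_even d_odd; elim/ltn_ind=> n IHn.
rewrite -(odd_double_half n) in IHn *; case: (odd n) IHn => IHn.
  by rewrite d_odd jrow_odd IHn // add1n ltnS -addnn leq_addl.
by rewrite d_even jrow_even.
Qed.

Lemma det_hankel_jrow n : \det (\matrix_(i < n, j < n) jrow (i + j) 0%N) = 1.
Proof.
pose L := \matrix_(i < n, j < n) jrow i j.
have -> : \matrix_(i < n, j < n) jrow (i + j) 0%N = L *m L^T.
  (* The length [n + n] exceeds [i + j]; the terms from [n] on vanish by triangularity. *)
  apply/matrixP => i j; rewrite !mxE -(@dot_jrow _ _ (n + n)); last first.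
    by rewrite -addnS leq_add // ltnW.
  rewrite big_split_ord /= [X in _ + X]big1 ?addr0.
    by apply: eq_bigr => k _; rewrite !mxE.
  by move=> k _; rewrite jrow_gt ?mul0r // ltn_addr.
have trigL : is_trig_mx L.
  by apply/is_trig_mxP => i j lt_ij; rewrite mxE jrow_gt.
rewrite det_mulmx det_tr det_trig // big1 ?mulr1 // => i _.
by rewrite mxE jrow_diag.
Qed.

End Jacobi.

(** Mod 2 the quotient is z^q / (1 + z^q) = z^q + z^(2q) + ...; multiplying by the denominator gives
    a recurrence with step [q]. *)
Lemma series_quot_mod2 (Q : {poly int}) q n : (0 < q)%N ->
    Q`_0 \is a GRing.unit ->
    map_poly intr Q = 1 + 'X^q :> {poly 'F_2} ->
  (series_quot ('X^q) Q n)%:~R = ((0 < n)%N && (q %| n)%N)%:R :> 'F_2.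
Proof.
move=> q_gt0 UQ Q2; set c := series_quot _ _.
have Q2i i : (Q`_i)%:~R = (i == 0%N)%:R + (i == q)%:R :> 'F_2.
  by rewrite -coef_map Q2 coefD coef1 coefXn.
have rec m : (c m)%:~R + (if (q <= m)%N then (c (m - q)%N)%:~R else 0)
    = (m == q)%:R :> 'F_2.
  have := congr1 (fun x : int => x%:~R : 'F_2) (series_quotP ('X^q) UQ m).
  rewrite /= coefXn rmorph_nat => <-; rewrite rmorph_sum /=.
  under [in RHS]eq_bigr do rewrite rmorphM /= Q2i mulrDr.
  rewrite big_split /=; congr (_ + _).
    rewrite big_ord_recr /= subnn eqxx mulr1 big1 ?add0r // => i _.
    by rewrite subn_eq0 leqNgt ltn_ord mulr0.
  case: leqP => [le_qm | lt_mq].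
    have lt_mq : (m - q < m.+1)%N by rewrite ltnS leq_subr.
    rewrite (bigD1 (Ordinal lt_mq)) //= subKn // eqxx mulr1 big1 ?addr0 //.
    move=> i /eqP ne_i; case: eqP => [e|_]; last by rewrite mulr0.
    case: ne_i; apply/val_inj; rewrite /= -e subKn //.
    by rewrite -ltnS ltn_ord.
  rewrite big1 // => i _; rewrite ltn_eqF ?mulr0 //.
  by rewrite (leq_ltn_trans (leq_subr _ _)).
elim/ltn_ind: n => n IHn; have := rec n; case: (leqP q n) => [le_qn | lt_nq].
  have n_gt0 := leq_trans q_gt0 le_qn.
  rewrite (IHn (n - q)%N) ?ltn_subrL ?q_gt0 // subn_gt0 dvdn_subl // n_gt0.
  move/(canRL (addrK _)) ->; case: ltngtP le_qn => // [lt_qn | ->] _.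
    by rewrite sub0r; case: (q %| n)%N; apply/val_inj.
  by rewrite dvdnn /= subr0.
rewrite addr0 (ltn_eqF lt_nq) => ->; case: n lt_nq {IHn} => //= n lt_nq.
by rewrite gtnNdvd.
Qed.

(** Only the denominators mod 2 matter, so both sequences are covered at once. *)
Lemma det_hankel_neq0 (u : nat -> int) (Q : nat -> {poly int}) n :
    (forall k, (Q k)`_0 \is a GRing.unit) ->
    (forall k, map_poly intr (Q k) = 1 + 'X^(2 ^ k)%N :> {poly 'F_2}) ->
    series_sum (fun k => series_quot ('X^(2 ^ k)%N) (Q k)) (genser1 u) ->
  \det (hankel 1 n u) != 0.
Proof.
move=> UQ Q2 sum_u.
have u_sum m : exists K0, forall K, (K0 <= K)%N ->
    (u m.+1)%:~R = \sum_(k < K) (2 ^ k %| m.+1)%N%:R :> 'F_2.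
  have [K0 uK0] := sum_u m.+1; exists K0 => K /uK0 /= <-.
  rewrite rmorph_sum; apply: eq_bigr => k _ /=.
  by rewrite series_quot_mod2 // expn_gt0.
have u_jrow m : (u m.+1)%:~R = jrow m 0%N.
  apply: (jrow_unique (d := fun m => (u m.+1)%:~R)) => {m} m.
    (* At an odd argument only the term [k = 0] survives. *)
    have [K uK] := u_sum m.*2; rewrite (uK K.+1) // big_ord_recl dvd1n.
    rewrite big1 ?addr0 // => k _; rewrite lift0 expnS.
    case: (boolP (_ %| _)%N) => // /(dvdn_trans (dvdn_mulr _ (dvdnn 2))).
    by rewrite dvdn2 /= odd_double.
  (* A common cutoff beyond both thresholds. The extra successor accounts for the term [k = 0]; in
     the others, 2^(k+1) divides 2(m+1) iff 2^k divides m+1. *)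
  have [K uK] := u_sum m.*2.+1; have [K' uK'] := u_sum m.
  rewrite (uK (maxn K K').+1) ?(uK' (maxn K K')) ?leq_maxr //; last first.
    by rewrite leqW // leq_maxl.
  rewrite big_ord_recl dvd1n; congr (_ + _); apply: eq_bigr => k _.
  by rewrite lift0 expnS -doubleS -mul2n dvdn_pmul2l.
suff: (\det (hankel 1 n u))%:~R = 1 :> 'F_2.
  by apply: contra_eq_neq => ->; rewrite eq_sym oner_eq0.
rewrite -det_map_mx -(det_hankel_jrow n); congr (\det _).
by apply/matrixP => i j; rewrite !mxE -u_jrow add1n addSn.
Qed.

Theorem theorem1p2 (g f : nat -> int)
    (hg : series_sum
            (fun k => series_quot ('X^(2 ^ k)%N) (1 - 'X^(2 ^ k)%N : {poly int}))
            (genser1 g))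
    (hf : series_sum
            (fun k => series_quot ('X^(2 ^ k)%N) (1 + 'X^(2 ^ k)%N : {poly int}))
            (genser1 f))
    (n : nat) (hn : (1 <= n)%N) :
  \det (hankel 1 n g) != 0 /\ \det (hankel 1 n f) != 0.
Proof.
have X0 k : ('X^(2 ^ k)%N : {poly int})`_0 = 0.
  by rewrite coefXn eq_sym expn_eq0.
split.
  apply: (det_hankel_neq0 (Q := fun k => 1 - 'X^(2 ^ k)%N)) hg => k.
    by rewrite coefB coef1 X0 subr0 unitr1.
  rewrite rmorphB /= rmorph1 map_polyXn; congr (_ + _).
  by apply/polyP => i; rewrite coefN; apply/eqP; rewrite eq_sym -addr_eq0 addFF2.
apply: (det_hankel_neq0 (Q := fun k => 1 + 'X^(2 ^ k)%N)) hf => k.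
  by rewrite coefD coef1 X0 addr0 unitr1.
by rewrite rmorphD /= rmorph1 map_polyXn.
Qed.
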